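(* Let $\rho_a$ be a Borel probability measure on $\mathbb{R}^n$, $\rho_b$ a Borel probability measure on $\mathbb{R}^m$, and $c:\mathbb{R}^n\times\mathbb{R}^m\to\mathbb{R}$ a continuous cost bounded from below. If the max-min problem $\sup_f\inf_T\mathcal{L}(T,f)$ admits a saddle point $(\bar T,\bar f)$, then $\mathcal{L}(\bar T,\bar f)=C(\rho_a,\rho_b)$.
   Context: The general OT cost is $C(\rho_a,\rho_b)=\inf_{\pi\in\Pi(\rho_a,\rho_b)}\int c(x,y)\,d\pi(x,y)$, where $\Pi(\rho_a,\rho_b)$ is the set of probability measures on $\mathbb{R}^n\times\mathbb{R}^m$ with marginals $\rho_a$ and $\rho_b$. The Lagrangian is, for Borel maps $T:\mathbb{R}^n\to\mathbb{R}^m$ and functions $f\in L^1(\rho_b)$, $$\mathcal{L}(T,f)=\int_{\mathbb{R}^n}\big[c(x,T(x))-f(T(x))\big]\,d\rho_a(x)+\int_{\mathbb{R}^m}f(y)\,d\rho_b(y),$$ with the first integral understood as an extended real number whenever it is well defined (values in $(-\infty,+\infty]$ allowed). A saddle point $(\bar T,\bar f)$ means $\mathcal{L}(\bar T,f)\le\mathcal{L}(\bar T,\bar f)\le\mathcal{L}(T,\bar f)$ for all admissible $T,f$. *)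

(* Defs.v *)
From HB Require Import structures.
From mathcomp Require Import all_boot all_order all_algebra.
From mathcomp Require Import all_classical all_reals all_analysis.
Set Implicit Arguments. Unset Strict Implicit. Unset Printing Implicit Defensive.
Import Order.TTheory GRing.Theory Num.Theory.
Import numFieldNormedType.Exports.
Local Open Scope classical_set_scope.
Local Open Scope ring_scope.

Definition borel (T : topologicalType) := g_sigma_algebraType (@open T).

Notation Bor R n := (borel 'rV[R]_n).
Notation Bor2 R n m := (borel ('rV[R]_n * 'rV[R]_m)%type).

Section OT.
Context (R : realType) (n m : nat).
Variables (ra : probability (Bor R n) R) (rb : probability (Bor R m) R)
  (c : 'rV[R]_n * 'rV[R]_m -> R).

Definition couplings : set (probability (Bor2 R n m) R) :=
  [set pi | (forall A : set (Bor R n), measurable A ->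
               pi (A `*` setT) = ra A) /\
            (forall B : set (Bor R m), measurable B ->
               pi (setT `*` B) = rb B)].

(* C(rho_a, rho_b) = inf over couplings of int c dpi (c bounded below, so each
   integral is a well-defined element of (-oo, +oo]). *)
Definition OTcost : \bar R :=
  ereal_inf [set (\int[pi]_z (c z)%:E)%E | pi in couplings].

Definition admissible_map (T : 'rV[R]_n -> 'rV[R]_m) : Prop :=
  measurable_fun setT (T : Bor R n -> Bor R m).

Definition admissible_fun (f : 'rV[R]_m -> R) : Prop :=
  measurable_fun setT (f : Bor R m -> R) /\
  rb.-integrable setT (fun y => (f y)%:E).

Definition lag_integrand (T : 'rV[R]_n -> 'rV[R]_m) (f : 'rV[R]_m -> R)
  : Bor R n -> \bar R := fun x => (c (x, T x) - f (T x))%:E.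

(* The first integral of the Lagrangian is well defined as an element of
   (-oo, +oo]: the negative part of the integrand has finite integral. *)
Definition lag_welldef T f : Prop :=
  (\int[ra]_x ((lag_integrand T f)^\- x) < +oo)%E.

Definition Lag T f : \bar R :=
  (\int[ra]_x lag_integrand T f x + \int[rb]_y (f y)%:E)%E.

Definition saddle_point Tb fb : Prop :=
  [/\ admissible_map Tb, admissible_fun fb, lag_welldef Tb fb,
      (forall f, admissible_fun f -> lag_welldef Tb f ->
          (Lag Tb f <= Lag Tb fb)%E) &
      (forall T, admissible_map T -> lag_welldef T fb ->
          (Lag Tb fb <= Lag T fb)%E)].

End OT.

(* Main.v *)
Require Import Defs.
From HB Require Import structures.
From mathcomp Require Import all_boot all_order all_algebra.
From mathcomp Require Import all_classical all_reals all_analysis.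
From mathcomp Require Import measurable_realfun lra.
Import Order.TTheory GRing.Theory Num.Theory.
Import numFieldNormedType.Exports.
Set Implicit Arguments.
Unset Strict Implicit.
Unset Printing Implicit Defensive.
Local Open Scope classical_set_scope.
Local Open Scope ring_scope.

(* Write h(x, y) = c(x, y) - fb(y).

   L(Tb, fb) <= C: let pi be a coupling of finite cost.  The graph of fb is a
   subset of a second countable space, so some countable set D of points y has
   the points (y, fb y) dense in the graph.  As c is continuous, minimising
   h(x, .) over D is as good as minimising over the whole space, and a Borel map
   T with values in D can be chosen with h(x, T x) almost minimal; neither a
   measurable selection theorem nor a disintegration of pi is needed.  To keep
   h(x, T x) integrable one minimises |h + N| - N, which is bounded below and
   dominates h; integrating against pi and letting N tend to infinity yields
   L(Tb, fb) <= \int c dpi.  This covers the value +oo as well.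

   C <= L(Tb, fb): when L(Tb, fb) is finite, testing its maximality in f against
   fb + 1_B and fb - 1_B shows that Tb pushes rho_a to rho_b, so (id, Tb) pushes
   rho_a to a coupling of cost L(Tb, fb). *)

(** * Second countability and Borel sets *)

Lemma second_countable_seq (T : topologicalType) : @second_countable T ->
  exists B : nat -> set T, (forall k, open (B k)) /\
    forall x A, nbhs x A -> exists k, B k x /\ B k `<=` A.
Proof.
(* An empty base forces the space to be empty, and the constant family [set0] then has the second
   property vacuously. *)
move=> [B cB [oB bB]]; move/pfcard_geP : cB => [B0|[s]].
  exists (fun=> set0); split; first by move=> _; exact: open0.
  by move=> x A /bB[U []]; rewrite B0.
exists s; split; first by move=> k; apply: oB; exact: (@funS _ _ _ _ s).
move=> x A /bB[U [BU Ux] UA].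
have [k _ skU] := @surj _ _ _ _ s U BU.
by exists k; rewrite skU.
Qed.

Lemma seq_second_countable (T : topologicalType) (I : countType)
    (B : I -> set T) : (forall i, open (B i)) ->
  (forall x A, nbhs x A -> exists i, B i x /\ B i `<=` A) ->
  @second_countable T.
Proof.
move=> oB bB; exists (range B).
  exact: sub_countable (card_image_le _ _) (countableP _).
split; first by move=> _ [i _ <-].
by move=> x A /bB[i [Bix BiA]]; exists (B i) => //; split=> //; exists i.
Qed.

(** The base consists of the balls of radius [k.+1%:R^-1] around the points [p i]; interiors are
    taken because balls of a pseudometric space need not be open. *)
Lemma separable_second_countable (R : realType) (T : pseudoMetricType R)
    (I : countType) (p : I -> T) :
  (forall x (e : R), 0 < e -> exists i, ball (p i) e x) -> @second_countable T.
Proof.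
move=> dp.
apply: (@seq_second_countable _ (I * nat)%type
  (fun ik => (ball (p ik.1) ik.2.+1%:R^-1)°)) => [ik|x A].
  exact: open_interior.
rewrite -nbhs_ballE => -[e /= e0 xeA].
have [k ke] : exists k : nat, k.+1%:R^-1 < e / 2.
  have /ltr_add_invr[k] : 0 < e / 2 by rewrite divr_gt0.
  by rewrite add0r; exists k.
have k0 : 0 < k.+1%:R^-1 :> R by rewrite invr_gt0.
(* Half the radius: [x] then lies in the interior of the ball around [p i], not merely in the
   ball. *)
have [i ix] := dp x (k.+1%:R^-1 / 2) (divr_gt0 k0 (ltr0Sn _ _)).
exists (i, k); split => /=.
  rewrite /interior -nbhs_ballE; exists (k.+1%:R^-1 / 2) => /=.
    by rewrite divr_gt0.
  by move=> y xy; rewrite [X in ball _ X](splitr k.+1%:R^-1);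
    exact: ball_triangle ix xy.
move=> y /interior_subset iy; apply: xeA.
rewrite [X in ball _ X](splitr e).
apply: (@ball_triangle _ _ (p i)).
  apply: ball_sym; apply: le_ball ix.
  apply: ltW; apply: le_lt_trans ke.
  by rewrite ler_pdivrMr// ler_peMr// ?ltW// ltr1n.
by apply: le_ball iy; exact: ltW.
Qed.

Lemma rat_ball (R : realType) (x e : R) : 0 < e ->
  exists q, ball (ratr q : R) e x.
Proof.
move=> e0; have [q] : exists q, ratr q \in `](x - e), (x + e)[.
  by apply: rat_in_itvoo; lra.
rewrite in_itv/= => /andP[q1 q2]; exists q.
by rewrite /ball/= ltr_norml; apply/andP; split; lra.
Qed.

Lemma real_second_countable (R : realType) : @second_countable R.
Proof.
by apply: (@separable_second_countable R R rat ratr) => x e; exact: rat_ball.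
Qed.

Lemma rV_second_countable (R : realType) n : @second_countable 'rV[R]_n.
Proof.
apply: (@separable_second_countable R 'rV[R]_n 'rV[rat]_n (map_mx ratr)).
move=> x e e0; have /choice[q qx] (j : 'I_n) := rat_ball (x ord0 j) e0.
exists (\row_j q j); split=> // i j.
by rewrite !mxE ord1; exact: qx.
Qed.

Lemma prod_second_countable (T U : topologicalType) :
  @second_countable T -> @second_countable U ->
  @second_countable (T * U)%type.
Proof.
move=> /second_countable_seq[B [oB bB]] /second_countable_seq[C [oC bC]].
apply: (@seq_second_countable _ (nat * nat)%type
  (fun ij => B ij.1 `*` C ij.2)) => [ij|x A].
  rewrite openE => z [/= Bz Cz].
  by exists (B ij.1, C ij.2) => //=; split; exact: open_nbhs_nbhs.
move=> [[A1 A2] /= [/bB[i [Bix BiA]] /bC[j [Cjx CjA]]] sA].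
exists (i, j); split=> // z [/= zB zC]; apply: sA; split => /=.
  exact: BiA.
exact: CjA.
Qed.

(** One point is picked from the preimage of each basic open set; where that preimage is empty,
    [get] returns a harmless default. With [g] the graph map of [fb], this yields the countable set
    of test points. *)
Lemma dense_image_seq (T : pointedType) (S : topologicalType) (g : T -> S) :
  @second_countable S -> exists t : nat -> T,
    forall y A, nbhs (g y) A -> exists j, A (g (t j)).
Proof.
move=> /second_countable_seq[B [oB bB]].
exists (fun k => get [set y | B k (g y)]) => y A /bB[k [Bky BkA]].
by exists k; apply: BkA; apply: (@getPex _ [set y | B k (g y)]); exists y.
Qed.

Lemma open_borel (T : ptopologicalType) (A : set T) :
  open A -> measurable (A : set (borel T)).
Proof. exact: sub_sigma_algebra. Qed.

Lemma measurable_fun_borel (d : measure_display) (X : measurableType d)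
    (U : ptopologicalType) (f : X -> U) :
  (forall A, open A -> measurable (f @^-1` A)) ->
  measurable_fun setT (f : X -> borel U).
Proof.
move=> mf; apply: (@measurability _ _ X (borel U) setT f (@open U)) => //.
by move=> _ [A oA <-]; rewrite setTI; exact: mf.
Qed.

Lemma measurable_fun_open_real (R : realType) (d : measure_display)
    (X : measurableType d) (f : X -> R) :
  (forall A, open A -> measurable (f @^-1` A)) -> measurable_fun setT f.
Proof.
move=> mf; apply: (measurability _ (RGenOpens.measurableE R)).
by move=> _ [_ [a [b ->] <-]]; rewrite setTI; apply: mf; exact: interval_open.
Qed.

Lemma measurable_preimage_open (d : measure_display) (X : measurableType d)
    (T : topologicalType) (B : nat -> set T) (f : X -> T) (A : set T) :
  (forall x A, nbhs x A -> exists k, B k x /\ B k `<=` A) ->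
  (forall k, measurable (f @^-1` B k)) ->
  open A -> measurable (f @^-1` A).
Proof.
move=> bB mB oA.
have -> : f @^-1` A = \bigcup_(k in [set k | B k `<=` A]) (f @^-1` B k).
  apply/seteqP; split=> x /=.
    move=> Afx; have [k [Bk kA]] := bB (f x) A (open_nbhs_nbhs (conj oA Afx)).
    by exists k.
  by move=> [k /= kA]; exact: kA.
by apply: bigcup_measurable => k _; exact: mB.
Qed.

(** The target carries the Borel sets of the product topology. Second countability writes each open
    set there as a countable union of rectangles, whose preimages are intersections of two
    measurable sets. *)
Lemma measurable_borel_pair (d : measure_display) (X : measurableType d)
    (T U : ptopologicalType) (f : X -> T) (g : X -> U) :
  @second_countable T -> @second_countable U ->
  measurable_fun setT (f : X -> borel T) ->
  measurable_fun setT (g : X -> borel U) ->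
  measurable_fun setT ((fun x => (f x, g x)) : X -> borel (T * U)%type).
Proof.
move=> /second_countable_seq[B [oB bB]] /second_countable_seq[C [oC bC]] mf mg.
(* Rectangles are enumerated by codes of pairs; [set0] fills the numbers that code nothing. *)
pose D (k : nat) : set (T * U)%type :=
  if @choice.unpickle (nat * nat)%type k is Some ij then B ij.1 `*` C ij.2
  else set0.
apply: (@measurability _ _ X (borel (T * U)%type) setT _ (@open (T * U)%type)).
  by [].
move=> _ [V oV <-]; rewrite setTI.
apply: (@measurable_preimage_open _ _ _ D) oV => [x A|k].
  move=> [[A1 A2] /= [/bB[i [Bix BiA]] /bC[j [Cjx CjA]]] sA].
  exists (choice.pickle (i, j)); rewrite /D choice.pickleK; split=> //.
  by move=> z [/= zB zC]; apply: sA; split => /=; [exact: BiA|exact: CjA].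
rewrite /D; case: choice.unpickle => [[i j]|]; last first.
  by rewrite preimage_set0; exact: measurable0.
have -> : (fun x => (f x, g x)) @^-1` (B i `*` C j) =
   (f @^-1` B i) `&` (g @^-1` C j) by [].
apply: measurableI.
  by rewrite -[X in measurable X]setTI; apply: mf => //; apply: open_borel.
by rewrite -[X in measurable X]setTI; apply: mg => //; apply: open_borel.
Qed.

(** [T x] is [t j] for the least index [j] whose value is within [e] of the infimum over the
    sequence, so measurability reduces to countably many comparisons of measurable functions. *)
Lemma measurable_almost_argmin (R : realType) (d d' : measure_display)
    (X : measurableType d) (Y : measurableType d') (t : nat -> Y)
    (F : X -> Y -> R) (b e : R) :
  (forall j, measurable_fun setT (F ^~ (t j))) ->
  (forall x y, b <= F x y) -> 0 < e ->
  exists2 T : X -> Y, measurable_fun setT T &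
    forall x j, F x (T x) <= F x (t j) + e.
Proof.
move=> mF Fb e0.
pose A j : set X := \bigcap_i [set x | F x (t j) <= F x (t i) + e].
have mA j : measurable (A j).
  apply: bigcap_measurable => // i _.
  rewrite -[X in measurable X]setTI.
  apply: (@measurable_fun_le _ _ _ setT (F ^~ (t j)) (fun x => F x (t i) + e)).
  - exact: measurableT.
  - exact: mF.
  - by apply: measurable_funD; [exact: mF|exact: measurable_cst].
have Aex x : exists j, `[< A j x >].
  pose S := range (fun j => F x (t j)).
  have S0 : S !=set0 by exists (F x (t 0%N)); exists 0%N.
  have Slb : has_lbound S by exists b => _ [j _ <-]; exact: Fb.
  have [_ [j _ <-] jS] := inf_adherent e0 (conj S0 Slb).
  exists j; apply/asboolP => i _ /=.
  apply: (le_trans (ltW jS)); rewrite lerD2r; apply: ge_inf => //.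
  by exists i.
pose J x := ex_minn (Aex x).
exists (t \o J); last first.
  move=> x j /=; rewrite /J; case: ex_minnP => k /asboolP Akx _.
  exact: (Akx j).
move=> _ B mB; rewrite setTI.
(* The least index equals [j] exactly on [A j] minus the earlier [A i]. *)
have -> : (t \o J) @^-1` B = \bigcup_(j in [set j | B (t j)])
    (A j `\` \bigcup_(i in [set i | (i < j)%N]) A i).
  apply/seteqP; split=> x /=.
    rewrite /J; case: ex_minnP => k /asboolP Akx kmin Bk.
    exists k => //; split=> // -[i /= ik Aix].
    by have := kmin i (asboolT Aix); rewrite leqNgt ik.
  move=> [j /= Bj [Ajx nA]]; rewrite /J; case: ex_minnP => k /asboolP Akx kmin.
  suff -> : k = j by [].
  apply/eqP; rewrite eqn_leq (kmin j (asboolT Ajx))/= leqNgt.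
  by apply/negP => kj; apply: nA; exists k.
apply: bigcup_measurable => j _; apply: measurableD => //.
by apply: bigcup_measurable.
Qed.

(** * Integration *)

Section image_measure.
Local Open Scope ereal_scope.
Context (R : realType) (d d' : measure_display) (X : measurableType d)
  (Y : measurableType d') (mu : {measure set X -> \bar R})
  (nu : {measure set Y -> \bar R}) (phi : X -> Y).
Hypothesis mphi : measurable_fun setT phi.
Hypothesis mu_nu : forall A, measurable A -> mu (phi @^-1` A) = nu A.

Lemma ge0_integral_image (f : Y -> \bar R) :
  measurable_fun setT f -> (forall y, 0 <= f y) ->
  \int[mu]_x f (phi x) = \int[nu]_y f y.
Proof.
move=> mf f0; transitivity (\int[pushforward mu phi]_y f y).
  by rewrite ge0_integral_pushforward// preimage_setT.
by apply: (eq_measure_integral nu) => // A mA _; exact: mu_nu.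
Qed.

(** Both sides split into positive and negative parts, which reduces the identity to the nonnegative
    case, infinite values included. It serves for the projections of a coupling and for the maps [T]
    and [(id, T)]. *)
Lemma integral_image (f : Y -> \bar R) : measurable_fun setT f ->
  \int[mu]_x f (phi x) = \int[nu]_y f y.
Proof.
move=> mf; rewrite integralE [RHS]integralE.
congr (_ - _).
  rewrite -(@ge0_integral_image f^\+)//; last exact: measurable_funepos.
  by apply: eq_integral => x _; rewrite !funeposE.
rewrite -(@ge0_integral_image f^\-)//; last exact: measurable_funeneg.
by apply: eq_integral => x _; rewrite !funenegE.
Qed.

Lemma integrable_image (f : Y -> \bar R) : measurable_fun setT f ->
  mu.-integrable setT (f \o phi) <-> nu.-integrable setT f.
Proof.
move=> mf; have e : \int[mu]_x `|f (phi x)| = \int[nu]_y `|f y|.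
  rewrite -(@ge0_integral_image (abse \o f))//; first exact: measurableT_comp.
  by move=> y; exact: abse_ge0.
split=> /integrableP[_ h]; apply/integrableP; split=> //.
- by rewrite -e.
- exact: measurableT_comp.
- by rewrite /= e.
Qed.

End image_measure.

Section integrability.
Local Open Scope ereal_scope.
Context (R : realType) (d : measure_display) (X : measurableType d).

(** Finiteness of the negative part lets the bound on the difference pass to the positive part. *)
Lemma integrable_of_integral_lty (mu : {measure set X -> \bar R})
    (f : X -> \bar R) : measurable_fun setT f ->
  \int[mu]_x f^\- x < +oo -> \int[mu]_x f x < +oo -> mu.-integrable setT f.
Proof.
move=> mf fn; rewrite integralE => fp; apply/integrableP; split => //.
have {}fn : \int[mu]_x f^\- x \is a fin_num.
  by rewrite ge0_fin_numE//; exact: integral_ge0.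
rewrite (_ : \int[mu]_x `|f x| = \int[mu]_x (f^\+ x + f^\- x)); last first.
  by apply: eq_integral => x _; rewrite -[LHS]/((abse \o f) x) fune_abse.
rewrite ge0_integralD//.
- apply: lte_add_pinfty; last by rewrite -ge0_fin_numE//; exact: integral_ge0.
  by move: fp; rewrite lteBlDr// -(fineK fn).
- exact: measurable_funepos.
- exact: measurable_funeneg.
Qed.

Lemma lower_bounded_neg_lty (mu : probability X R) (f : X -> R) (M : R) :
  measurable_fun setT f -> (forall x, M <= f x)%R ->
  \int[mu]_x (EFin \o f)^\- x < +oo.
Proof.
move=> mf Mf; apply: (@le_lt_trans _ _ (\int[mu]_x `|M|%:E)).
  apply: ge0_le_integral => //.
  - by apply: measurable_funeneg; exact/measurable_EFinP.
  - move=> x _; rewrite funenegE /= -EFin_max lee_fin ge_max normr_ge0 andbT.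
    by have := Mf x; have := ler_norm (- M)%R; rewrite normrN; lra.
by rewrite integral_cst// [X in _ * X]probability_setT mule1 ltry.
Qed.

End integrability.

Section truncation.
Context (R : realType).
Implicit Types N t : R.

(* Equal to [t] above [- N], above [t] and bounded below everywhere: an almost
   minimiser of [reflect_below N \o h] controls [h] from both sides. *)
Definition reflect_below N t : R := `|t + N| - N.

Lemma reflect_below_ge N t : - N <= reflect_below N t.
Proof. by rewrite /reflect_below; have := normr_ge0 (t + N); lra. Qed.

Lemma le_reflect_below N t : t <= reflect_below N t.
Proof. by rewrite /reflect_below; have := ler_norm (t + N); lra. Qed.

Lemma norm_reflect_below N t : 0 <= N -> `|reflect_below N t| <= `|t|.
Proof.
move=> N0; have := ler_dist_dist (t + N) N.
by rewrite addrK (ger0_norm N0).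
Qed.

(** Triangle inequality for [t = (t + N) - N]; it carries integrability back from the reflected
    function to the original one. *)
Lemma norm_le_reflect_below N t : 0 <= N ->
  `|t| <= `|reflect_below N t| + 2 * N.
Proof.
move=> N0; have := ler_normB (t + N) N; have := ler_norm (reflect_below N t).
by rewrite addrK (ger0_norm N0) /reflect_below; lra.
Qed.

Lemma reflect_below_id N t : - N <= t -> reflect_below N t = t.
Proof. by move=> Nt; rewrite /reflect_below ger0_norm; lra. Qed.

End truncation.

Section integrable_fin.
Context (R : realType) (d : measure_display) (X : measurableType d)
  (mu : probability X R).

Lemma integrable_norm_add_cst (g : X -> R) (k : R) :
  mu.-integrable setT (EFin \o g) ->
  mu.-integrable setT (EFin \o (fun x => `|g x| + k)).
Proof.
move=> ig; apply: (@integrableD _ _ _ mu setT measurableT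
  (EFin \o (fun x => `|g x|)) (EFin \o cst k)).
  exact: integrable_norm.
exact: finite_measure_integrable_cst.
Qed.

Lemma integrable_le_norm_add (f g : X -> R) (k : R) : measurable_fun setT f ->
  (forall x, `|f x| <= `|g x| + k) ->
  mu.-integrable setT (EFin \o g) -> mu.-integrable setT (EFin \o f).
Proof.
move=> mf fg ig; apply: le_integrable (integrable_norm_add_cst k ig) => //.
  exact/measurable_EFinP.
by move=> x _ /=; rewrite lee_fin (le_trans (fg x))// ler_norm.
Qed.

Lemma integrable_add_indic (g : X -> R) (s : R) (B : set X) : measurable B ->
  mu.-integrable setT (EFin \o g) ->
  mu.-integrable setT (EFin \o (fun x => g x + s * \1_B x)) /\
  (\int[mu]_x (g x + s * \1_B x)%:E =
    \int[mu]_x (g x)%:E + s%:E * mu B)%E.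
Proof.
move=> mB ig.
have iB : mu.-integrable setT (fun x => (\1_B x)%:E).
  exact: integrable_indic.
have isB : mu.-integrable setT (fun x => s%:E * (\1_B x)%:E)%E.
  exact: integrableZl.
split.
  exact: (@integrableD _ _ _ mu setT measurableT (EFin \o g) _ ig isB).
transitivity (\int[mu]_x ((EFin \o g) x + s%:E * (\1_B x)%:E))%E.
  by apply: eq_integral.
rewrite integralD//; congr (_ + _)%E.
by rewrite integralZl// integral_indic// setIT.
Qed.

End integrable_fin.

(** * Almost optimal maps *)

Section lagrangian.
Context (R : realType) (n m : nat).
Variables (ra : probability (Bor R n) R) (rb : probability (Bor R m) R)
  (c : 'rV[R]_n * 'rV[R]_m -> R).
Hypothesis c_cont : continuous c.

Lemma open_borel2 (A : set ('rV[R]_n * 'rV[R]_m)) :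
  open A -> measurable (A : set (Bor2 R n m)).
Proof. exact: sub_sigma_algebra. Qed.

Lemma measurable_graph_map (T : 'rV[R]_n -> 'rV[R]_m) : admissible_map T ->
  measurable_fun setT ((fun x => (x, T x)) : Bor R n -> Bor2 R n m).
Proof.
move=> mT; apply: (@measurable_borel_pair _ (Bor R n) 'rV[R]_n 'rV[R]_m id T).
- exact: rV_second_countable.
- exact: rV_second_countable.
- exact: measurable_id.
- exact: mT.
Qed.

Lemma measurable_cost : measurable_fun setT (c : Bor2 R n m -> R).
Proof.
move/continuousP : c_cont => cc.
by apply: measurable_fun_open_real => A /cc; exact: open_borel2.
Qed.

Lemma measurable_lag (T : 'rV[R]_n -> 'rV[R]_m) (f : 'rV[R]_m -> R) :
  admissible_map T -> measurable_fun setT (f : Bor R m -> R) ->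
  measurable_fun setT ((fun x => c (x, T x) - f (T x)) : Bor R n -> R).
Proof.
move=> mT mf; apply: measurable_funB.
  apply: (@measurableT_comp _ _ _ (Bor R n) (Bor2 R n m) R c setT
    (fun x => (x, T x))).
    exact: measurable_cost.
  exact: measurable_graph_map.
exact: (@measurableT_comp _ _ _ (Bor R n) (Bor R m) R f setT T).
Qed.

Lemma measurable_fst_borel :
  measurable_fun setT (fst : Bor2 R n m -> Bor R n).
Proof.
apply: measurable_fun_borel => A oA; apply: open_borel2.
by apply: open_comp oA => z _; exact: cvg_fst.
Qed.

Lemma measurable_snd_borel :
  measurable_fun setT (snd : Bor2 R n m -> Bor R m).
Proof.
apply: measurable_fun_borel => A oA; apply: open_borel2.
by apply: open_comp oA => z _; exact: cvg_snd.
Qed.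

Lemma continuous_reflect_below (S : topologicalType)
    (g : S -> 'rV[R]_n * 'rV[R]_m) (h : S -> R) (N : R) (s : S) :
  {for s, continuous g} -> {for s, continuous h} ->
  {for s, continuous (fun s => reflect_below N (c (g s) - h s))}.
Proof.
move=> cg ch; apply: cvgB; last exact: cvg_cst.
apply: cvg_norm; apply: cvgD; last exact: cvg_cst.
apply: cvgB; last exact: ch.
by apply: continuous_comp => //; exact: c_cont.
Qed.

(** Since [f] may be discontinuous, [f y] is replaced by an independent real variable [z.2]. The
    objective is continuous in [z], and the points [(t j, f (t j))], dense in the graph, come as
    close as desired to its value at any [(y, f y)]. *)
Lemma almost_argmin_map (f : 'rV[R]_m -> R) (N e : R) : 0 < e ->
  exists2 T, admissible_map T & forall x y,
    reflect_below N (c (x, T x) - f (T x)) <=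
    reflect_below N (c (x, y) - f y) + e.
Proof.
move=> e0; pose F x y := reflect_below N (c (x, y) - f y).
have [t tP] := @dense_image_seq 'rV[R]_m ('rV[R]_m * R)%type
  (fun y => (y, f y)) (prod_second_countable (rV_second_countable R m)
                                             (real_second_countable R)).
have Fc x z : {for z, continuous (fun z : 'rV[R]_m * R =>
    reflect_below N (c (x, z.1) - z.2))}.
  apply: (@continuous_reflect_below _ (fun z : 'rV[R]_m * R => (x, z.1)) snd).
    apply: (@cvg_pair _ _ _ (nbhs z) (nbhs x) (nbhs z.1) _ _ _ (fun=> x) fst).
      exact: cvg_cst.
    exact: cvg_fst.
  exact: cvg_snd.
have Fx y (x : 'rV[R]_n) : {for x, continuous (F ^~ y)}.
  apply: (@continuous_reflect_below _ (fun x : 'rV[R]_n => (x, y)) (cst (f y))).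
    apply: (@cvg_pair _ _ _ (nbhs x) (nbhs x) (nbhs y) _ _ _ id).
      exact: cvg_id.
    exact: cvg_cst.
  exact: cst_continuous.
(* Half of [e] pays for near-minimisation over the sequence [t], the other half for replacing an
   arbitrary [y] by some [t j]. *)
have [|||T mT Tmin] := @measurable_almost_argmin R _ _ (Bor R n) (Bor R m) t F
  (- N) (e / 2).
- move=> j; apply: measurable_fun_open_real => A oA; apply: open_borel.
  by apply: open_comp oA => x _; exact: (Fx (t j) x).
- by move=> x y; exact: reflect_below_ge.
- by rewrite divr_gt0.
exists T => // x y.
have /tP[j /= tj] : \forall z \near (y, f y),
    reflect_below N (c (x, z.1) - z.2) < F x y + e / 2.
  apply: (cvgr_lt _ (Fc x (y, f y))).
  by rewrite -[ltLHS]/(F x y); lra.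
by have := Tmin x j; rewrite /F in tj *; lra.
Qed.

End lagrangian.

(** * The two inequalities *)

Section weak_duality.
Context (R : realType) (n m : nat).
Variables (ra : probability (Bor R n) R) (rb : probability (Bor R m) R)
  (c : 'rV[R]_n * 'rV[R]_m -> R).
Hypothesis c_cont : continuous c.
Hypothesis c_lb : exists M : R, forall z, M <= c z.

Lemma lag_lower_bound_coupling (pi : probability (Bor2 R n m) R)
    (f : 'rV[R]_m -> R) (L : \bar R) :
  couplings ra rb pi -> admissible_fun rb f ->
  (forall T, admissible_map T -> lag_welldef ra c T f ->
    (L <= Lag ra rb c T f)%E) ->
  (L <= \int[pi]_z (c z)%:E)%E.
Proof.
move=> [pia pib] [mf fint] LT.
have [->|cy] := eqVneq (\int[pi]_z (c z)%:E)%E +oo%E; first exact: leey.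
have mc := measurable_cost c_cont.
have mfst := @measurable_fst_borel R n m.
have msnd := @measurable_snd_borel R n m.
have pia' (A : set (Bor R n)) : measurable A -> pi (fst @^-1` A) = ra A.
  move=> mA; rewrite -pia//; congr (pi _).
  by apply/seteqP; split=> [z//=|z []].
have pib' (A : set (Bor R m)) : measurable A -> pi (snd @^-1` A) = rb A.
  move=> mA; rewrite -pib//; congr (pi _).
  by apply/seteqP; split=> [z//=|z []].
have ic : pi.-integrable setT (EFin \o c).
  apply: integrable_of_integral_lty.
  - exact/measurable_EFinP.
  - by have [M cM] := c_lb; exact: (lower_bounded_neg_lty pi mc cM).
  - by rewrite ltey.
have mEf : measurable_fun setT (EFin \o f : Bor R m -> \bar R).
  exact/measurable_EFinP.
have if2 : pi.-integrable setT (EFin \o (fun z : Bor2 R n m => f z.2)).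
  exact/(integrable_image msnd pib' mEf).
have ef2 : (\int[pi]_z (f z.2)%:E = \int[rb]_y (f y)%:E)%E.
  exact: (integral_image msnd pib' mEf).
pose h (z : Bor2 R n m) := c z - f z.2.
have ih : pi.-integrable setT (EFin \o h).
  exact: (integrableB measurableT ic if2).
have mh : measurable_fun setT h.
  by apply/measurable_EFinP; exact: measurable_int ih.
have eh : (\int[pi]_z (c z)%:E =
    \int[pi]_z (h z)%:E + \int[rb]_y (f y)%:E)%E.
  rewrite -ef2 -integralD//; apply: eq_integral => z _.
  by rewrite -EFinD /h subrK.
(* One index drives both parameters: the reflection level tends to infinity while the tolerance
   tends to zero, staying at most 1 so that [|h| + 1] dominates every [u k]. *)
pose u (k : nat) (z : Bor2 R n m) := reflect_below k%:R (h z) + k.+1%:R^-1.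
have mreflect d (X : measurableType d) (g : X -> R) N :
    measurable_fun setT g ->
    measurable_fun setT (fun x => reflect_below N (g x)).
  move=> mg; apply: measurable_funB; last exact: measurable_cst.
  apply: measurableT_comp; first exact: normr_measurable.
  by apply: measurable_funD => //; exact: measurable_cst.
have mu_ k : measurable_fun setT (u k).
  by apply: measurable_funD; [exact: mreflect|exact: measurable_cst].
have k1 k : k.+1%:R^-1 <= 1 :> R by rewrite invf_le1// ler1n.
have k0 k : 0 < k.+1%:R^-1 :> R by rewrite invr_gt0.
have uh k z : `|u k z| <= `|h z| + 1.
  rewrite (le_trans (ler_normD _ _))// lerD//.
    exact: norm_reflect_below.
  by rewrite gtr0_norm.
have iu k : pi.-integrable setT (EFin \o u k).
  exact: integrable_le_norm_add (uh k) ih.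
have Lu k : (L <= \int[pi]_z (u k z)%:E + \int[rb]_y (f y)%:E)%E.
  have [T mT TP] := almost_argmin_map c_cont f k%:R (k0 k).
  pose l (x : Bor R n) := c (x, T x) - f (T x).
  pose g x := reflect_below k%:R (l x).
  have ml : measurable_fun setT l by exact: measurable_lag.
  have mg : measurable_fun setT g by exact: mreflect.
  (* Near-minimality of [T x] against every [y] is a pointwise inequality, so it can be integrated
     against [pi] with [x] and [y] the two coordinates of [z]. *)
  have gu (z : Bor2 R n m) : g z.1 <= u k z.
    by rewrite /u /h [z in c z]surjective_pairing; exact: TP.
  (* From [- k <= g z.1 <= u k z] follows [|g z.1| <= |u k z| + k]. *)
  have ig1 : pi.-integrable setT (EFin \o (fun z : Bor2 R n m => g z.1)).
    apply: (@integrable_le_norm_add _ _ _ pi _ (u k) k%:R) => //.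
      exact: (@measurableT_comp _ _ _ (Bor2 R n m) (Bor R n) R g setT fst).
    move=> z; have := gu z; have := reflect_below_ge k%:R (l z.1).
    rewrite -/(g z.1) ler_norml => h1 h2.
    have := ler_norm (u k z); have := normr_ge0 (u k z).
    have := ler0n R k.
    by move=> *; apply/andP; split; lra.
  have mEg : measurable_fun setT (EFin \o g) by exact/measurable_EFinP.
  have ig : ra.-integrable setT (EFin \o g).
    exact/(integrable_image mfst pia' mEg).
  (* Integrability of [l] makes the Lagrangian at [T] well defined, so that [LT] applies. *)
  have il : ra.-integrable setT (EFin \o l).
    apply: (@integrable_le_norm_add _ _ _ ra _ g (2 * k%:R)) => // x.
    exact: norm_le_reflect_below.
  apply: (le_trans (LT T mT _)).
    exact: integral_funeneg_lt_pinfty il.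
  rewrite /Lag leeD2r//; apply: (@le_trans _ _ (\int[ra]_x (g x)%:E)%E).
    apply: le_integral => //.
    by move=> x _; rewrite lee_fin; exact: le_reflect_below.
  rewrite -(integral_image mfst pia' mEg).
  apply: le_integral => //; first exact: iu.
  by move=> z _; rewrite lee_fin; exact: gu.
(* For fixed [z] the reflection is inactive once [k >= - h z]; only the harmonic term then
   remains. *)
have uE z : (EFin \o u ^~ z) @ \oo --> (h z)%:E.
  apply: cvg_EFin; first exact: nearW.
  rewrite -[h z]addr0; apply: cvgD; last exact: cvg_harmonic.
  apply: cvg_near_cst; near=> k; apply: reflect_below_id.
  rewrite lerNl (le_trans (ler_norm _))// normrN; near: k.
  exact: nbhs_infty_ger.
have [|||||_ _ ucvg] := @dominated_convergence _ _ _ pi setT measurableT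
  (fun k => EFin \o u k) (EFin \o h) (EFin \o (fun z => `|h z| + 1)).
- by move=> k; exact/measurable_EFinP.
- exact/measurable_EFinP.
- by apply: aeW => z _; exact: uE.
- exact: integrable_norm_add_cst.
- by apply: aeW => z k _; rewrite lee_fin; exact: uh.
rewrite eh.
have : (fun k => \int[pi]_z (u k z)%:E + \int[rb]_y (f y)%:E)%E @ \oo -->
    (\int[pi]_z (h z)%:E + \int[rb]_y (f y)%:E)%E.
  apply: cvgeD; [|exact: ucvg|exact: cvg_cst].
  by rewrite fin_num_adde_defl// integrable_fin_num.
by apply: cvge_ge; apply: nearW => k; exact: Lu.
Unshelve. all: by end_near. Qed.

End weak_duality.

(** * Push-forward property and cost of the saddle map *)

Section saddle.
Context (R : realType) (n m : nat).
Variables (ra : probability (Bor R n) R) (rb : probability (Bor R m) R)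
  (c : 'rV[R]_n * 'rV[R]_m -> R).
Hypothesis c_cont : continuous c.

Lemma lag_argmax_image (T : 'rV[R]_n -> 'rV[R]_m) (f : 'rV[R]_m -> R) :
  admissible_map T -> admissible_fun rb f ->
  ra.-integrable setT (lag_integrand c T f) ->
  (forall g, admissible_fun rb g -> lag_welldef ra c T g ->
    (Lag ra rb c T g <= Lag ra rb c T f)%E) ->
  forall B : set (Bor R m), measurable B -> ra (T @^-1` B) = rb B.
Proof.
move=> mT [mf fint] il fmax B mB.
have mTB : measurable (T @^-1` B : set (Bor R n)).
  by rewrite -[X in measurable X]setTI; exact: mT.
pose p := fine (ra (T @^-1` B)); pose q := fine (rb B).
have pE : ra (T @^-1` B) = p%:E by rewrite fineK// fin_num_measure.
have qE : rb B = q%:E by rewrite fineK// fin_num_measure.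
pose a := fine (\int[ra]_x lag_integrand c T f x)%E.
pose b := fine (\int[rb]_y (f y)%:E)%E.
have aE : (\int[ra]_x lag_integrand c T f x = a%:E)%E.
  by rewrite fineK// integrable_fin_num.
have bE : (\int[rb]_y (f y)%:E = b%:E)%E.
  by rewrite fineK// integrable_fin_num.
(* All terms being finite, passing from [f] to [f + s 1_B] changes the Lagrangian by
   [s * q - s * p], which maximality forbids to be positive. The values 1 and -1 of [s] then give
   [p = q]. *)
have perturb (s : R) : s * q <= s * p.
  pose g y := f y + s * \1_B y.
  have [ig eg] := @integrable_add_indic _ _ _ rb f s B mB fint.
  have [il' el] := @integrable_add_indic _ _ _ ra
    (fun x => c (x, T x) - f (T x)) (- s) _ mTB il.
  have lagE : lag_integrand c T g =
      (fun x => (c (x, T x) - f (T x) + - s * \1_(T @^-1` B) x)%:E).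
    apply/funext => x; rewrite /lag_integrand /g; congr EFin.
    by rewrite opprD addrA mulNr.
  have := fmax g; rewrite /lag_welldef /Lag lagE el eg.
  rewrite -/(lag_integrand c T f) aE bE pE qE -!EFinM -!EFinD lee_fin.
  have mg : admissible_fun rb g.
    by split => //; apply/measurable_EFinP; exact: measurable_int ig.
  move=> /(_ mg (integral_funeneg_lt_pinfty measurableT il')).
  by lra.
rewrite pE qE; congr EFin.
by have := perturb 1; have := perturb (-1); lra.
Qed.

(** By change of variables the integral of [f \o T] against [ra] cancels that of [f] against [rb],
    leaving the cost of the coupling induced by [(id, T)]. *)
Lemma lag_image_cost (T : 'rV[R]_n -> 'rV[R]_m) (f : 'rV[R]_m -> R) :
  admissible_map T -> admissible_fun rb f ->
  ra.-integrable setT (lag_integrand c T f) ->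
  (forall B : set (Bor R m), measurable B -> ra (T @^-1` B) = rb B) ->
  (OTcost ra rb c <= Lag ra rb c T f)%E.
Proof.
move=> mT [mf fint] il rab.
have mG := measurable_graph_map mT.
pose G : {mfun Bor R n >-> Bor2 R n m} :=
  HB.pack (fun x : Bor R n => ((x, T x) : Bor2 R n m))
    (isMeasurableFun.Build _ _ _ _ _ mG).
pose pi : probability (Bor2 R n m) R := distribution ra G.
have mEf : measurable_fun setT (EFin \o f : Bor R m -> \bar R).
  exact/measurable_EFinP.
have ifT : ra.-integrable setT (EFin \o (fun x : Bor R n => f (T x))).
  exact/(integrable_image mT rab mEf).
apply: ereal_inf_lbound; exists pi.
  split => [A mA|B mB].
    by congr (ra _); apply/seteqP; split=> [x []|x Ax].
  by rewrite -rab//; congr (ra _); apply/seteqP; split=> [x []|x Ax].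
have mc : measurable_fun setT (EFin \o c : Bor2 R n m -> \bar R).
  by apply/measurable_EFinP; exact: measurable_cost.
rewrite -(@integral_image _ _ _ _ _ ra pi G mG _ _ mc)//.
rewrite /Lag -(integral_image mT rab mEf) -integralD//.
by apply: eq_integral => x _; rewrite /lag_integrand -EFinD subrK.
Qed.

End saddle.

Theorem theorem3 (R : realType) (n m : nat)
  (ra : probability (Bor R n) R) (rb : probability (Bor R m) R)
  (c : 'rV[R]_n * 'rV[R]_m -> R)
  (c_cont : continuous c)
  (c_lb : exists M : R, forall z, M <= c z)
  (Tb : 'rV[R]_n -> 'rV[R]_m) (fb : 'rV[R]_m -> R) :
  saddle_point ra rb c Tb fb ->
  Lag ra rb c Tb fb = OTcost ra rb c.
Proof.
move=> [mT admf wd fmax Tmin].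
have le_cost : (Lag ra rb c Tb fb <= OTcost ra rb c)%E.
  apply: le_ereal_inf_tmp => _ [pi cpi <-].
  exact: (lag_lower_bound_coupling c_cont c_lb cpi admf).
apply/eqP; rewrite eq_le le_cost/=.
have [->|lagy] := eqVneq (Lag ra rb c Tb fb) +oo%E; first exact: leey.
have il : ra.-integrable setT (lag_integrand c Tb fb).
  apply: integrable_of_integral_lty => //.
    by apply/measurable_EFinP; apply: measurable_lag => //; case: admf.
  (* The integral of [fb] is finite, so an infinite first integral would make the whole Lagrangian
     [+oo]. *)
  rewrite ltey; apply: contra_neq lagy; rewrite /Lag => ->.
  by case: admf => _ /integrable_fin_num/fineK <-.
apply: lag_image_cost => //.
exact: lag_argmax_image fmax.
Qed.
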